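(* For every $m\in\mathbb{N}\setminus\{0\}$, there exists a Lipschitz continuous and piecewise-$C^\infty$ function $f\colon\mathbb{R}^m\to\mathbb{R}$, with a representation $(\{P^j\}_{j=1}^J,\{f^j\}_{j=1}^J)$ whose interface $$\mathcal I\coloneqq\bigcup_{\substack{j,\ell\in\{1,\ldots,J\}\\ j\ne\ell}}\bigl(\operatorname{cl}P^j\cap\operatorname{cl}P^\ell\bigr)$$ is Lebesgue negligible, such that the graph $\{(x,f(x)):x\in\mathbb{R}^m\}\subset\mathbb{R}^{m+1}$ of $f$ admits no Whitney stratification.
   Context: A continuous function $f\colon\mathbb{R}^m\to\mathbb{R}$ is piecewise-$C^\infty$ if there exist a finite Borel partition $\mathbb{R}^m=\bigsqcup_{j=1}^J P^j$ (nonempty, pairwise disjoint Borel sets) and $C^\infty$ functions $f^1,\ldots,f^J\colon\mathbb{R}^m\to\mathbb{R}$ with $f(x)=f^j(x)$ whenever $x\in P^j$; the pair $(\{P^j\},\{f^j\})$ is a representation of $f$. $\operatorname{cl}$ denotes closure. Whitney stratification (meaning here a $C^1$ stratification with Whitney's condition (a)): let $X\subset\mathbb{R}^d$ and $I\subset\mathbb{N}$. A Whitney stratification of $X$ is a locally finite partition $\mathcal S=\{S_i\}_{i\in I}$ of $X$ (each point of $X$ has a neighborhood meeting only finitely many strata) into pairwise disjoint $C^1$ (embedded) submanifolds of $\mathbb{R}^d$, called strata (not assumed connected), such that: (1) Frontier condition: for any two strata $S,R\in\mathcal S$, $S\cap\operatorname{cl}R\ne\varnothing$ implies $S\subset\operatorname{cl}R$.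 (2) Whitney's condition (a): whenever $S,R\in\mathcal S$ satisfy $S\subset\operatorname{cl}R$, and $(x_\ell)_{\ell\in\mathbb{N}}\subset R$ converges to a point $x\in S$ such that the tangent spaces $T_{x_\ell}R$ converge (in the Grassmannian of $(\dim R)$-dimensional linear subspaces of $\mathbb{R}^d$) to a linear subspace $L$, one has $T_xS\subset L$. *)

(* Defs.v *)
From HB Require Import structures.
From mathcomp Require Import all_boot all_order all_algebra.
From mathcomp Require Import all_classical all_reals all_analysis.
Set Implicit Arguments.
Unset Strict Implicit.
Unset Printing Implicit Defensive.
Import Order.TTheory GRing.Theory Num.Theory.
Import numFieldNormedType.Exports.
Local Open Scope classical_set_scope.
Local Open Scope ring_scope.

(* [U] is meant to be open, so that the (total) directional derivatives
   'D_v f x at the points x of U only depend on f on U. *)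
Fixpoint Ck_on (R : realType) (V W : normedModType R) (k : nat) (U : set V)
    (f : V -> W) : Prop :=
  match k with
  | 0 => forall x, U x -> {for x, continuous f}
  | k'.+1 => (forall x, U x -> differentiable f x) /\
             (forall v : V, Ck_on k' U ('D_v f))
  end.

Definition smooth (R : realType) (V W : normedModType R) (f : V -> W) : Prop :=
  forall k, Ck_on k [set: V] f.

Definition borel (T : topologicalType) (A : set T) : Prop :=
  <<s [set B : set T | open B] >> A.

Definition box (R : realType) (m : nat) (a b : 'rV[R]_m) : set 'rV[R]_m :=
  [set x | forall i, a 0 i <= x 0 i <= b 0 i].

Definition box_volume (R : realType) (m : nat) (a b : 'rV[R]_m) : R :=
  \prod_(i < m) (b 0 i - a 0 i).

Definition lebesgue_outer (R : realType) (m : nat) (A : set 'rV[R]_m) : \bar R :=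
  ereal_inf [set v : \bar R | exists a b : nat -> 'rV[R]_m,
    [/\ forall n i, a n 0 i <= b n 0 i,
        A `<=` \bigcup_n box (a n) (b n) &
        v = (\sum_(0 <= n <oo) (box_volume (a n) (b n))%:E)%E]].

Definition lebesgue_negligible (R : realType) (m : nat) (A : set 'rV[R]_m) :=
  lebesgue_outer A = 0%E.

Definition is_representation (R : realType) (m J : nat) (f : 'rV[R]_m -> R)
    (P : 'I_J -> set 'rV[R]_m) (fs : 'I_J -> 'rV[R]_m -> R) : Prop :=
  [/\ partition [set: 'I_J] P [set: 'rV[R]_m],
      forall j, borel (P j),
      forall j, smooth (fs j) &
      forall j x, P j x -> f x = fs j x].

Definition piecewise_smooth (R : realType) (m : nat) (f : 'rV[R]_m -> R) :=
  continuous f /\ exists J (P : 'I_J -> set 'rV[R]_m) fs,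
    is_representation f P fs.

Definition interface (R : realType) (m J : nat) (P : 'I_J -> set 'rV[R]_m) :
    set 'rV[R]_m :=
  [set x | exists j l, j != l /\ (closure (P j) `&` closure (P l)) x].

Definition graph (R : realType) (m : nat) (f : 'rV[R]_m -> R) :
    set 'rV[R]_(m + 1) :=
  [set row_mx x (f x)%:M | x in [set: 'rV[R]_m]].

(* R^k x {0} inside R^d *)
Definition coord_subspace (R : realType) (d k : nat) : set 'rV[R]_d :=
  [set y | forall i : 'I_d, (k <= i)%N -> y 0 i = 0].

Definition C1_diffeo (R : realType) (d : nat) (U V : set 'rV[R]_d)
    (phi psi : 'rV[R]_d -> 'rV[R]_d) : Prop :=
  [/\ open U, open V,
      (forall x, U x -> V (phi x) /\ psi (phi x) = x) /\
      (forall y, V y -> U (psi y) /\ phi (psi y) = y),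
      Ck_on 1 U phi & Ck_on 1 V psi].

(* embedded, of constant dimension [k] *)
Definition C1_submanifold (R : realType) (d k : nat) (S : set 'rV[R]_d) : Prop :=
  (k <= d)%N /\ forall p, S p -> exists U V phi psi,
    [/\ U p, C1_diffeo U V phi psi &
        phi @` (S `&` U) = V `&` coord_subspace k].

(* velocities at x of the C^1 curves drawn on S *)
Definition tangent_space (R : realType) (d : nat) (S : set 'rV[R]_d)
    (x : 'rV[R]_d) : set 'rV[R]_d :=
  [set v | exists (e : R) (c : R -> 'rV[R]_d),
    [/\ 0 < e, Ck_on 1 (`]- e, e[%classic : set R) c,
        forall t, `]- e, e[%classic t -> S (c t), c 0 = x & 'D_1 c 0 = v]].

(* [P] is the matrix, acting on row vectors, of the orthogonal projection of
   R^d onto the k-dimensional linear subspace [L]. *)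
Definition is_orthoproj (R : realType) (d k : nat) (L : set 'rV[R]_d)
    (P : 'M[R]_d) : Prop :=
  [/\ P^T = P, P *m P = P, \rank P = k & L = [set v | (v <= P)%MS]].

(* The Grassmannian of k-planes of R^d carries the topology given by its
   identification with the set of orthogonal projections of rank k. *)
Definition grassmannian_cvg (R : realType) (d k : nat)
    (L_ : nat -> set 'rV[R]_d) (L : set 'rV[R]_d) : Prop :=
  exists (P_ : nat -> 'M[R]_d) (P : 'M[R]_d),
    [/\ forall l, is_orthoproj k (L_ l) (P_ l),
        is_orthoproj k L P & P_ @ \oo --> P].

Definition locally_finite (T : topologicalType) (X : set T) (I : set nat)
    (S : nat -> set T) : Prop :=
  forall x, X x -> exists2 U, nbhs x U &
    finite_set [set i | I i /\ S i `&` U !=set0].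

Definition frontier_condition (T : topologicalType) (I : set nat)
    (S : nat -> set T) : Prop :=
  forall i j, I i -> I j -> S i `&` closure (S j) !=set0 ->
    S i `<=` closure (S j).

Definition whitney_a (R : realType) (d : nat) (I : set nat)
    (S : nat -> set 'rV[R]_d) : Prop :=
  forall i j, I i -> I j -> S i `<=` closure (S j) ->
  forall (k : nat) (u : nat -> 'rV[R]_d) (x : 'rV[R]_d) (L : set 'rV[R]_d),
    C1_submanifold k (S j) -> (forall l, S j (u l)) -> S i x ->
    u @ \oo --> x ->
    grassmannian_cvg k (fun l => tangent_space (S j) (u l)) L ->
    tangent_space (S i) x `<=` L.

Definition whitney_stratification (R : realType) (d : nat) (X : set 'rV[R]_d)
    (I : set nat) (S : nat -> set 'rV[R]_d) : Prop :=
  [/\ partition I S X /\ locally_finite X I S,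
      forall i, I i -> exists k, C1_submanifold k (S i),
      frontier_condition I S &
      whitney_a I S].

(* Main.v *)
Require Import Defs.
From HB Require Import structures.
From mathcomp Require Import all_boot all_order all_algebra.
From mathcomp Require Import all_classical all_reals all_analysis.
From mathcomp Require Import ring lra zify.
Set Implicit Arguments.
Unset Strict Implicit.
Unset Printing Implicit Defensive.
Import Order.TTheory GRing.Theory Num.Theory.
Import numFieldNormedType.Exports.
Local Open Scope classical_set_scope.
Local Open Scope ring_scope.

(**
For a closed null set K in R with gaps ]a, b[, let g vanish on K and equal
exp(-1/(x-a)) exp(-1/(b-x)) (1/(x-a) - 1/(b-x)) on each gap: g is smooth with
bounded derivative, flat on K, and has one simple zero in each gap, so |g| has
a convex kink at the midpoint of every gap.  Take for K the periodic Cantor set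
and f x = sum_i |g (x_i)|, which is smooth on each set where the signs of the
g (x_i) are prescribed.

Let t in K be an accumulation point of K and let S be the stratum through the
point of the graph over (t, ..., t).  If S had positive dimension it would
contain a C^1 curve with nonzero velocity through that point.  Some coordinate
x_i then moves with nonzero speed (the height does not, as g is flat at t), so by
the intermediate value theorem the curve crosses, transversally, a hyperplane
{x_i = midpoint of a gap}; there the height of the curve is a sum of absolute
values of differentiable functions, one of which has a simple zero, and since
convex kinks do not cancel it is not differentiable.  Hence S has dimension 0
and its points are isolated.  There are countably many strata, so K would be
countable.
*)

(* The middle-third Cantor set and all its integer translates: the removed
   intervals are ](3k+1)/3^(n+1), (3k+2)/3^(n+1)[. *)
Definition cantor (R : realType) : set R :=
  [set x | forall (n : nat) (k : int),
     ~~ ((3 * k + 1)%:~R < 3 ^+ n.+1 * x < (3 * k + 2)%:~R)].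

(** * The periodic Cantor set: closed, null and uncountable *)

Section cantor_set.
Variable R : realType.
Implicit Types (x y : R).

Lemma cantor_closed : closed (@cantor R).
Proof.
have -> : @cantor R = ~` \bigcup_n \bigcup_(k : int)
    ((fun x : R => 3 ^+ n.+1 * x) @^-1` `](3 * k + 1)%:~R, (3 * k + 2)%:~R[).
  apply/seteqP; split => x /=.
    by move=> Kx [n _ [k _ /=]]; rewrite in_itv/=; exact/negP/Kx.
  by move=> Ux n k; apply/negP => xnk; apply: Ux; exists n => //; exists k.
apply: open_closedC; apply: bigcup_open => n _; apply: bigcup_open => k _.
apply: open_comp; last exact: interval_open.
by move=> x _; exact: mulrl_continuous.
Qed.

Lemma cantorN x : cantor x -> cantor (- x).
Proof.
move=> Kx n k; apply/negP => /andP[lo hi]; have /negP := Kx n (- k - 1); apply.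
rewrite (_ : 3 * (- k - 1) + 1 = - (3 * k + 2)); last by lia.
rewrite (_ : 3 * (- k - 1) + 2 = - (3 * k + 1)); last by lia.
by rewrite !intrN; move: lo hi; rewrite mulrN; lra.
Qed.

Lemma cantor_int (z : int) : cantor (z%:~R : R).
Proof.
move=> n k; have -> : (3 : R) ^+ n.+1 = (3 ^+ n.+1 : int)%:~R by rewrite rmorphXn.
by rewrite -intrM !ltr_int; lia.
Qed.

Lemma cantor_third (p : nat) (k : int) x : cantor x ->
  k%:~R <= 3 ^+ p * x <= (k + 1)%:~R ->
  (3 * k)%:~R <= 3 ^+ p.+1 * x <= (3 * k + 1)%:~R \/
  (3 * k + 2)%:~R <= 3 ^+ p.+1 * x <= (3 * k + 2 + 1)%:~R.
Proof.
move=> /(_ p k) Kx; move: Kx; rewrite exprS -mulrA.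
set y := 3 ^+ p * x; rewrite !(intrD, intrM) negb_and -!leNgt.
by case/orP => Hy /andP[lo hi]; [left|right]; lra.
Qed.

(** Each use of [cantor_third] replaces a triadic interval by its two outer thirds, so n steps
    multiply the length 3^-p by (2/3)^n. The induction is on n for all p and k. *)
Lemma cantor_measure_le (n p : nat) (k : int) :
  (lebesgue_measure (@cantor R `&` [set x | (k%:~R <= 3 ^+ p * x <= (k + 1)%:~R)%R])
     <= ((2 / 3) ^+ n * 3 ^- p)%:E)%E.
Proof.
elim: n p k => [|n IH] p k.
  rewrite expr0 mul1r.
  apply: (@le_trans _ _ (lebesgue_measure (`[k%:~R / 3 ^+ p, (k + 1)%:~R / 3 ^+ p] : set R))).
    apply: le_mu_ext => x [_ /= /andP[lo hi]]; rewrite in_itv/=.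
    by rewrite ler_pdivrMr ?exprn_gt0// ler_pdivlMr ?exprn_gt0// !(mulrC x) lo.
  rewrite lebesgue_measure_itv/= lte_fin.
  case: ifPn => _; last by rewrite lee_fin invr_ge0 exprn_ge0.
  by rewrite -EFinD lee_fin -mulrBl intrD/= addrAC subrr add0r mul1r.
apply: (@le_trans _ _ (lebesgue_measure
  ((@cantor R `&` [set x | ((3 * k)%:~R <= 3 ^+ p.+1 * x <= (3 * k + 1)%:~R)%R]) `|`
   (@cantor R `&` [set x | ((3 * k + 2)%:~R <= 3 ^+ p.+1 * x <= (3 * k + 2 + 1)%:~R)%R])))).
  apply: le_mu_ext => x [Kx /= xk].
  by case: (cantor_third Kx xk) => ?; [left|right].
apply: le_trans; first exact: outer_measureU2.
apply: (le_trans (leeD (IH _ _) (IH _ _))).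
rewrite -EFinD lee_fin !exprS invfM.
by rewrite le_eqVlt; apply/orP; left; apply/eqP; field; rewrite expf_neq0.
Qed.

Lemma cantor_measure0 : lebesgue_measure (@cantor R) = 0%E.
Proof.
suff K0 (k : int) : lebesgue_measure (@cantor R `&` [set x | (k%:~R <= x <= (k + 1)%:~R)%R]) = 0%E.
  (* Unit intervals with integer left ends are enumerated through [unpickle]; a number coding no
     integer falls back to the left end 0. *)
  pose F n := @cantor R `&` [set x | (odflt 0 (unpickle n : option int))%:~R <= x
                                  <= (odflt 0 (unpickle n : option int) + 1)%:~R].
  apply/eqP; rewrite eq_le measure_ge0 andbT.
  apply: (@le_trans _ _ (lebesgue_measure (\bigcup_n F n))).
    apply: le_mu_ext => x Kx; exists (pickle (Num.floor x)) => //; split => //=.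
    by rewrite pickleK /= ge_floor ltW ?floorD1_gt.
  apply: (le_trans (outer_measure_sigma_subadditive (wlength idfun)^*%mu F)).
  by rewrite eseries0// => n _ _; exact: K0.
apply/eqP; rewrite eq_le measure_ge0 andbT; apply/lee_addgt0Pr => e e0.
rewrite add0e.
have /cvgrPdist_lt/(_ _ e0)[n _ /(_ n (leqnn n))] : (2 / 3 : R) ^+ n @[n --> \oo] --> 0.
  by apply: cvg_expr; rewrite ger0_norm; lra.
rewrite sub0r normrN ger0_norm ?exprn_ge0// => /ltW en.
have := cantor_measure_le n 0 k; rewrite expr0 invr1 mulr1 => H.
apply: (le_trans (le_trans _ H)); last by rewrite lee_fin.
by apply: le_mu_ext => x [Kx xk]; split; rewrite //= mul1r.
Qed.

(* The left end, scaled by 3^n, of a triadic interval of level n of the Cantor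
   construction that avoids s 0, ..., s (n - 1). *)
Fixpoint cantor_avoid (s : nat -> R) (n : nat) : int :=
  if n is n'.+1 then
    let N := cantor_avoid s n' in
    if 3 ^+ n * s n' <= (3 * N + 1)%:~R then 3 * N + 2 else 3 * N
  else 0.

(** The triadic intervals are closed and nested, so the supremum of the left ends stays below every
    right end. *)
Lemma cantor_avoid_lim (s : nat -> R) : exists x : R, forall n,
  (cantor_avoid s n)%:~R <= 3 ^+ n * x <= (cantor_avoid s n + 1)%:~R.
Proof.
set N := cantor_avoid s.
have NS n : 3 * N n <= N n.+1 <= 3 * N n + 2 by rewrite /N /=; case: ifP => _; lia.
have p3 n : 0 < (3 : R) ^+ n by rewrite exprn_gt0.
pose a n : R := (N n)%:~R / 3 ^+ n; pose b n : R := (N n + 1)%:~R / 3 ^+ n.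
have ab n : a n <= b n by rewrite ler_pM2r ?invr_gt0// ler_int; lia.
have aS n : a n <= a n.+1.
  rewrite /a exprS invfM mulrCA mulrA ler_pM2r ?invr_gt0//.
  rewrite ler_pdivlMl ?ltr0n// -(intrM _ 3) ler_int; have := NS n; lia.
have bS n : b n.+1 <= b n.
  rewrite /b exprS invfM mulrCA mulrA ler_pM2r ?invr_gt0//.
  rewrite ler_pdivrMl ?ltr0n// -(intrM _ 3) ler_int; have := NS n; lia.
have leab m n : a m <= b n.
  have /nondecreasing_seqP ai : forall n, a n <= a n.+1 by [].
  have /nonincreasing_seqP bi : forall n, b n.+1 <= b n by [].
  apply: (le_trans (ai _ _ (leq_maxl m n))).
  by apply: (le_trans (ab _)); exact: bi (leq_maxr m n).
exists (sup (range a)) => n.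
apply/andP; split.
  rewrite -ler_pdivrMl// mulrC; apply: ub_le_sup; last by exists n.
  by exists (b 0%N) => _ [m _ <-].
rewrite -ler_pdivlMl// mulrC.
by apply: ge_sup; [exists (a 0%N), 0%N|move=> _ [m _ <-]; exact: leab].
Qed.

Lemma cantor_uncountable : ~ countable (@cantor R).
Proof.
move=> /pfcard_geP[K0|[s]].
  by have := @cantor_int 0; rewrite K0.
have [x xs] := cantor_avoid_lim s.
have Kx : cantor x.
  (* The scaled left end at level n + 1 is 0 or 2 modulo 3, whereas meeting a removed interval would
     force it to be 3k + 1. *)
  move=> n k; apply/negP => /andP[lo hi]; have := xs n.+1 => /andP[lo' hi'].
  have := le_lt_trans lo' hi; have := lt_le_trans lo hi'.
  by rewrite !ltr_int /=; case: ifP => _; lia.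
have [n _ sn] := @surj _ _ _ _ s x Kx.
(* With N the scaled left end at level n: if 3^(n+1) s_n <= 3N + 1 then 3^(n+1) x >= 3N + 2,
   otherwise 3^(n+1) x <= 3N + 1 < 3^(n+1) s_n. *)
have := xs n.+1; rewrite -sn /=; case: ifPn => [|/negbTE] H.
  by move=> /andP[/le_trans /(_ H)]; rewrite ler_int; lia.
by move=> /andP[_]; rewrite H.
Qed.
End cantor_set.

(** * Functions flat at the origin and their derivatives *)

Section flat_functions.
Variable R : realType.
Implicit Types (t x : R).

(** This gives the derivative where no local formula is available: at 0 for [flat], at Cantor points
    for [gapf]. *)
Lemma is_derive_quadratic (f : R -> R) x (C : R) :
  (forall y, `|f y - f x| <= C * (y - x) ^+ 2) -> is_derive x 1 f 0.
Proof.
move=> fC; apply/is_derive1_caratheodory.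
(* At z = x the quotient is 0 / 0 = 0, the value required of the Caratheodory slope. *)
exists (fun z => (f z - f x) / (z - x)); split.
- move=> z; have [->|zx] := eqVneq z x; first by rewrite !subrr mulr0.
  by rewrite divfK// subr_eq0.
- have C0 : 0 <= C.
    by have := fC (x + 1); rewrite addrAC subrr add0r expr1n mulr1; exact: le_trans.
  rewrite /prop_for /continuous_at !subrr mul0r; apply/cvgrPdist_lt => e e0.
  near=> z; rewrite sub0r normrN normf_div.
  have [->|zx] := eqVneq z x; first by rewrite !subrr normr0 mul0r.
  rewrite ltr_pdivrMr ?normr_gt0 ?subr_eq0//; apply: (le_lt_trans (fC z)).
  rewrite -real_normK ?num_real// expr2 mulrA ltr_pM2r ?normr_gt0 ?subr_eq0//.
  apply: (@le_lt_trans _ _ ((C + 1) * `|z - x|)).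
    by rewrite ler_wpM2r//; lra.
  rewrite mulrC -ltr_pdivlMr; last by lra.
  rewrite distrC; near: z; apply/nbhs_ballP; exists (e / (C + 1)) => //=.
  by rewrite divr_gt0//; lra.
- by rewrite !subrr mul0r.
Unshelve. all: by end_near. Qed.

(** The factor t^-n makes the span of the family stable under differentiation. *)
Definition flat (n : nat) t : R := if 0 < t then t ^- n * expR (- t^-1) else 0.

Lemma flat_ge0 n t : 0 <= flat n t.
Proof.
rewrite /flat; case: ifPn => // t0.
by rewrite mulr_ge0 ?expR_ge0// invr_ge0 exprn_ge0// ltW.
Qed.

Lemma flat_gt0 n t : 0 < t -> 0 < flat n t.
Proof. by move=> t0; rewrite /flat t0 mulr_gt0 ?expR_gt0// invr_gt0 exprn_gt0. Qed.

Lemma flat_le0 n t : t <= 0 -> flat n t = 0.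
Proof. by rewrite /flat ltNge => ->. Qed.

Lemma flatS n t : 0 < t -> flat n.+1 t = t^-1 * flat n t.
Proof. by move=> t0; rewrite /flat t0 exprS invfM mulrA. Qed.

(** The exponential series bounds exp(1/t) below by its term t^-(n+2) / (n+2)!, which absorbs t^-n
    and leaves t^2. *)
Lemma flat_le n t : flat n t <= (n.+2)`!%:R * t ^+ 2.
Proof.
have [t0|t0] := ltP 0 t; last by rewrite flat_le0// mulr_ge0// sqr_ge0.
rewrite /flat t0 expRN.
have F0 : 0 < (n.+2)`!%:R :> R by rewrite ltr0n fact_gt0.
have := @expR_ge1Dxn _ t^-1 n.+1; rewrite invr_ge0 ltW// => /(_ isT) H.
have {H} : t^-1 ^+ n.+2 / (n.+2)`!%:R <= expR t^-1 by apply: le_trans H; lra.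
rewrite ler_pdivrMr// => H.
rewrite ler_pdivrMr ?expR_gt0// -[t ^- n]mulr1 ler_pdivrMl ?exprn_gt0//.
have := ler_wpM2l (exprn_ge0 n.+2 (ltW t0)) H.
rewrite exprVn divff ?gt_eqF ?exprn_gt0// => /le_trans; apply.
by rewrite le_eqVlt; apply/orP; left; apply/eqP; rewrite !exprS; ring.
Qed.

Lemma is_derive_flat n t :
  is_derive t 1 (flat n) (flat n.+2 t - n%:R * flat n.+1 t).
Proof.
have [t0|t0|t0] := ltgtP t 0.
- rewrite !flat_le0 ?ltW// mulr0 subr0.
  apply: (@near_eq_is_derive _ _ _ (cst 0)).
  by near do rewrite flat_le0 ?ltW//; exact: lt_nbhsl.
- apply: (@near_eq_is_derive _ _ _ (fun s : R => s ^- n * expR (- s^-1))).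
    near=> s; rewrite /flat ifT//; near: s; exact: lt_nbhsr.
  have tn0 : t ^+ n != 0 by rewrite gt_eqF// exprn_gt0.
  have t1 : t != 0 by rewrite gt_eqF.
  have dV := is_deriveV t1 (is_derive_id t (1 : R)).
  have dX := is_deriveX n (is_derive_id t (1 : R)).
  have dXV := is_deriveV (f := (id : R -> R) ^+ n) (_ : _ != 0) dX.
  have dN : is_derive t 1 (fun s : R => - s^-1) (t ^- 2).
    by apply: (is_derive_eq (is_deriveN dV)); rewrite /GRing.scale /= mulr1 opprK.
  have dE : is_derive t 1 (fun s : R => expR (- s^-1)) (expR (- t^-1) * t ^- 2).
    exact: (is_derive1_comp (f := expR) (g := fun s : R => - s^-1)).
  have {}dXV : is_derive t 1 (fun s : R => s ^- n) (- n%:R * t ^- n.+1).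
    apply: is_derive_eq.
      apply: (near_eq_is_derive _ (dXV _)); last by rewrite exprfctE.
      by near=> s; rewrite /= exprfctE.
    rewrite exprfctE /= /GRing.scale /= mulr1.
    case: (n) => [|n']; first by rewrite !mulr0n oppr0 !(mul0r, mulr0).
    by rewrite !exprS; field; rewrite expf_neq0.
  have := is_deriveM dXV dE.
  move/is_derive_eq; apply; rewrite /flat t0 !exprS /= /GRing.scale /=.
  by rewrite expr0; field; rewrite ?tn0 ?t1.
- rewrite t0 !flat_le0// mulr0 subr0.
  apply: (@is_derive_quadratic _ _ (n.+2)`!%:R) => y.
  rewrite subr0 [flat n 0]flat_le0// subr0 ger0_norm ?flat_ge0//.
  exact: flat_le.
Unshelve. all: by end_near. Qed.
End flat_functions.

(** * Countability of sets of isolated points *)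

Section isolated.
Variable R : realType.

(** Each t in D is the only point of D between two suitable rationals, and this pair of rationals is
    an injective code for t. *)
Lemma isolated_countable (D : set R) :
  (forall t, D t -> exists2 e, 0 < e & forall t', D t' -> `|t' - t| < e -> t' = t) ->
  countable D.
Proof.
move=> isoD.
have /choice[q qP] : forall t : R, exists q : rat * rat, D t ->
    ratr q.1 < t < ratr q.2 /\
    forall t', D t' -> ratr q.1 < t' < ratr q.2 -> t' = t.
  move=> t; have [Dt|] := pselect (D t); last by exists (0, 0).
  have [e e0 te] := isoD t Dt.
  have /rat_in_itvoo[q1] : t - e < t by lra.
  have /rat_in_itvoo[q2] : t < t + e by lra.
  rewrite !in_itv/= => /andP[q21 q22] /andP[q11 q12].
  exists (q1, q2) => _ /=; split=> [|t' Dt' /andP[? ?]]; first by rewrite q12.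
  by apply: te => //; rewrite ltr_norml; apply/andP; split; lra.
apply/countable_injP; exists (fun t => pickle (q t)) => s t.
rewrite !inE => Ds Dt /(pcan_inj pickleK) st.
have [sq _] := qP s Ds; have [_ tq] := qP t Dt.
by apply: tq => //; rewrite -st.
Qed.
End isolated.

(** * Gaps of the Cantor set and flat functions on them *)

Section gaps.
Variable R : realType.
Implicit Types x y : R.

(** In a gap, [cprev] and [cnext] are its two ends; on the Cantor set both are the identity.
    Integers lie in [cantor], so both values are within 1 of x. *)
Definition cprev x : R := sup (@cantor R `&` [set y | y <= x]).
(** Reflection in 0 preserves [cantor], so facts on [cnext] follow from those on [cprev]. *)
Definition cnext x : R := - cprev (- x).

Lemma cprev_has_sup x : has_sup (@cantor R `&` [set y | y <= x]).
Proof.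
split; last by exists x => y [].
by exists (Num.floor x)%:~R; split; [exact: cantor_int|exact: ge_floor].
Qed.

Lemma cprev_le x : cprev x <= x.
Proof. by apply: ge_sup; [case: (cprev_has_sup x)|move=> y []]. Qed.

Lemma le_cprev x y : cantor y -> y <= x -> y <= cprev x.
Proof. by move=> Ky yx; apply: ub_le_sup; [case: (cprev_has_sup x)|]. Qed.

Lemma cprev_ge x : x - 1 <= cprev x.
Proof.
apply: le_trans (le_cprev (@cantor_int R (Num.floor x)) (ge_floor x)).
by have := floorD1_gt x; rewrite intrD; lra.
Qed.

Lemma cantor_cprev x : cantor (cprev x).
Proof.
have [ne ub] := cprev_has_sup x; have := closure_sup ne ub.
move=> /(closure_subset (@subIsetl _ _ _)).
by rewrite -(closure_id _).1//; exact: cantor_closed.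
Qed.

Lemma cnext_ge x : x <= cnext x.
Proof. by rewrite lerNr cprev_le. Qed.

Lemma cnext_le x y : cantor y -> x <= y -> cnext x <= y.
Proof. by move=> Ky xy; rewrite lerNl le_cprev ?lerN2//; exact: cantorN. Qed.

Lemma cnext_le1 x : cnext x <= x + 1.
Proof. by rewrite lerNl; have := cprev_ge (- x); lra. Qed.

Lemma cantor_cnext x : cantor (cnext x).
Proof. exact/cantorN/cantor_cprev. Qed.

Lemma cprev_lt x : ~ cantor x -> cprev x < x.
Proof.
move=> Kx; rewrite lt_neqAle cprev_le andbT; apply/eqP => xE; apply: Kx.
by rewrite -xE; exact: cantor_cprev.
Qed.

Lemma cnext_gt x : ~ cantor x -> x < cnext x.
Proof.
move=> Kx; rewrite lt_neqAle cnext_ge andbT; apply/eqP => xE; apply: Kx.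
by rewrite xE; exact: cantor_cnext.
Qed.

(** No Cantor point lies strictly between the two ends, except possibly x itself: one above x is at
    least [cnext x], one below x at most [cprev x]. *)
Lemma gap_eq x y : cprev x < y < cnext x -> cprev y = cprev x /\ cnext y = cnext x.
Proof.
move=> /andP[xy yx]; split; apply/eqP; rewrite eq_le; apply/andP; split.
- have [yx'|yx'] := leP (cprev y) x; first exact/le_cprev/yx'/cantor_cprev.
  have := cnext_le (@cantor_cprev y) (ltW yx'); have := cprev_le y; lra.
- by apply: le_cprev (ltW xy); exact: cantor_cprev.
- by apply: cnext_le (ltW yx); exact: cantor_cnext.
- have [yx'|yx'] := leP x (cnext y); first exact/cnext_le/yx'/cantor_cnext.
  have := le_cprev (@cantor_cnext y) (ltW yx'); have := cnext_ge y; lra.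
Qed.

Lemma cprev_id x : cantor x -> cprev x = x.
Proof. by move=> Kx; apply/eqP; rewrite eq_le cprev_le le_cprev. Qed.

Lemma cprevN x : cprev (- x) = - cnext x.
Proof. by rewrite opprK. Qed.

Lemma cnextN x : cnext (- x) = - cprev x.
Proof. by rewrite /cnext opprK. Qed.

(** With u and v the distances from x to the ends of its gap, this is exp(-1/u) exp(-1/v) / (u^i
    v^j), extended by 0 to the Cantor set. *)
Definition gapf (i j : nat) x : R := flat i (x - cprev x) * flat j (cnext x - x).

Lemma gapfN i j x : gapf i j (- x) = gapf j i x.
Proof. by rewrite /gapf cprevN cnextN !opprK mulrC addrC [- x + _]addrC. Qed.

Lemma gapf_cantor i j x : cantor x -> gapf i j x = 0.
Proof. by move=> Kx; rewrite /gapf cprev_id// subrr [flat i 0]flat_le0// mul0r. Qed.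

Lemma gapf_ge0 i j x : 0 <= gapf i j x.
Proof. by rewrite mulr_ge0// flat_ge0. Qed.

(** The end of the gap of y on the side of x lies between x and y, so [flat_le] bounds one factor by
    (y - x)^2 up to a constant; the other factor is bounded because the distance to the other end is
    at most 1. *)
Lemma gapf_quadratic i j x y : cantor x ->
  gapf i j y <= (i.+2)`!%:R * (j.+2)`!%:R * (y - x) ^+ 2.
Proof.
move=> Kx; set a : R := _`!%:R; set b : R := _`!%:R.
have a0 : 0 <= a by []. have b0 : 0 <= b by [].
have ha : flat i (y - cprev y) <= a * (y - cprev y) ^+ 2 := flat_le _ _.
have hb : flat j (cnext y - y) <= b * (cnext y - y) ^+ 2 := flat_le _ _.
have := cprev_le y; have := cprev_ge y; have := cnext_ge y; have := cnext_le1 y.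
move=> n1 n0 p1 p0.
have le_sqr (u v : R) : 0 <= u -> u <= v -> u ^+ 2 <= v ^+ 2.
  by move=> u0 uv; rewrite lerXn2r// nnegrE// (le_trans u0).
have bound1 (c u : R) : 0 <= c -> 0 <= u <= 1 -> c * u ^+ 2 <= c.
  move=> c0 /andP[u0 u1]; rewrite -[leRHS]mulr1 ler_wpM2l//.
  by have := le_sqr u 1 u0 u1; rewrite expr1n.
have [xy|yx] := leP x y.
  have px := le_cprev Kx xy; rewrite mulrAC /gapf.
  apply: ler_pM; rewrite ?flat_ge0//.
    by apply: (le_trans ha); rewrite ler_wpM2l// le_sqr; lra.
  by apply: (le_trans hb); rewrite bound1//; lra.
have nx := cnext_le Kx (ltW yx); rewrite -mulrA /gapf.
apply: ler_pM; rewrite ?flat_ge0//.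
  by apply: (le_trans ha); rewrite bound1//; lra.
rewrite -sqrrN opprB; apply: (le_trans hb); rewrite ler_wpM2l// le_sqr; lra.
Qed.

Lemma gapf_le i j x : gapf i j x <= (i.+2)`!%:R * (j.+2)`!%:R.
Proof.
apply: (le_trans (gapf_quadratic i j x (@cantor_cprev x))).
rewrite -[leRHS]mulr1 ler_wpM2l ?mulr_ge0//.
by rewrite expr_le1//; have := cprev_le x; have := cprev_ge x; lra.
Qed.

(** At a Cantor point every term is 0 and the quadratic bound applies. In a gap the ends are locally
    constant, so this is the product rule. *)
Lemma is_derive_gapf i j x : is_derive x 1 (gapf i j)
  (gapf i.+2 j x - i%:R * gapf i.+1 j x - gapf i j.+2 x + j%:R * gapf i j.+1 x).
Proof.
have [Kx|Kx] := pselect (cantor x).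
  rewrite !gapf_cantor// !mulr0 !subr0 addr0.
  apply: (@is_derive_quadratic _ _ _ ((i.+2)`!%:R * (j.+2)`!%:R)) => y.
  by rewrite [gapf i j x]gapf_cantor// subr0 ger0_norm ?gapf_ge0// gapf_quadratic.
pose f y : R := flat i (y - cprev x) * flat j (cnext x - y).
have dl : is_derive x 1 (fun y : R => flat i (y - cprev x))
    (flat i.+2 (x - cprev x) - i%:R * flat i.+1 (x - cprev x)).
  have d : is_derive x 1 (fun y : R => y - cprev x) 1.
    exact: is_derive_shift.
  by apply: is_derive_eq (is_derive1_comp (is_derive_flat i _) d) _; rewrite mulr1.
have dr : is_derive x 1 (fun y : R => flat j (cnext x - y))
    (- (flat j.+2 (cnext x - x) - j%:R * flat j.+1 (cnext x - x))).
  have d : is_derive x 1 (fun y : R => cnext x - y) (- 1).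
    apply: is_derive_eq (is_deriveB (is_derive_cst (cnext x) x 1)
      (is_derive_id x 1)) _; by rewrite add0r.
  by apply: is_derive_eq (is_derive1_comp (is_derive_flat j _) d) _; rewrite mulrN1.
apply: (@near_eq_is_derive _ _ _ f).
  near=> y; rewrite /gapf /f.
  have [|-> -> //] := @gap_eq x y.
  apply/andP; split; near: y.
    by apply: lt_nbhsr; exact: cprev_lt.
  by apply: lt_nbhsl; exact: cnext_gt.
apply: is_derive_eq (is_deriveM dl dr) _.
by rewrite /gapf /GRing.scale /=; ring.
Unshelve. all: by end_near. Qed.
End gaps.

(** * Calculus of linear combinations of gap functions *)

Section gap_combinations.
Variable R : realType.
Implicit Types (x y : R) (s : seq (R * (nat * nat))).

(** Combinations are kept as lists of coefficients and exponents, so that differentiation is an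
    operation on lists and can be iterated. *)
Definition gapcomb s x : R := \sum_(c <- s) c.1 * gapf c.2.1 c.2.2 x.

Definition dgapcomb s : seq (R * (nat * nat)) :=
  flatten [seq let: (c, (i, j)) := t in
    [:: (c, (i.+2, j)); (- c * i%:R, (i.+1, j)); (- c, (i, j.+2)); (c * j%:R, (i, j.+1))]
    | t <- s].

Lemma is_derive_gapcomb s x : is_derive x 1 (gapcomb s) (gapcomb (dgapcomb s) x).
Proof.
elim: s => [|[c [i j]] s IH].
  rewrite /dgapcomb /= /gapcomb big_nil; apply: (@near_eq_is_derive _ _ _ (cst 0)).
  by near=> y; rewrite big_nil.
apply: (@near_eq_is_derive _ _ _ (c *: gapf i j + gapcomb s)).
  by near=> y; rewrite /gapcomb big_cons.
apply: is_derive_eq (is_deriveD (is_deriveZ c (is_derive_gapf i j x)) IH) _.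
rewrite /gapcomb /dgapcomb /= !big_cons /= /GRing.scale /= !addrA; congr (_ + _).
ring.
Unshelve. all: by end_near. Qed.

Lemma gapcomb_cantor s x : cantor x -> gapcomb s x = 0.
Proof. by move=> Kx; rewrite /gapcomb big1// => c _; rewrite gapf_cantor// mulr0. Qed.

Lemma gapcomb_continuous s : continuous (gapcomb s).
Proof.
move=> x; apply: differentiable_continuous; apply/derivable1_diffP.
by have [] := is_derive_gapcomb s x.
Qed.

Lemma gapcomb_bounded s : exists2 C : R, 0 <= C & forall x, `|gapcomb s x| <= C.
Proof.
exists (\sum_(c <- s) `|c.1| * ((c.2.1.+2)`!%:R * (c.2.2.+2)`!%:R)).
  by apply: sumr_ge0 => c _; rewrite !mulr_ge0.
move=> x; apply: (le_trans (ler_norm_sum _ _ _)); apply: ler_sum => c _.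
by rewrite normrM ler_wpM2l// ger0_norm ?gapf_ge0// gapf_le.
Qed.

(** The derivative is again a combination, hence bounded, and the mean value theorem applies. *)
Lemma gapcomb_lipschitz s :
  exists2 C : R, 0 <= C & forall x y, `|gapcomb s x - gapcomb s y| <= C * `|x - y|.
Proof.
have [C C0 hC] := gapcomb_bounded (dgapcomb s).
exists C => // x y.
wlog xy : x y / x <= y.
  by move=> H; have [/H//|/ltW/H] := leP x y; rewrite distrC [`|y - x|]distrC.
have [||c _ E] := @MVT_segment R (gapcomb s) (gapcomb (dgapcomb s)) x y xy.
- by move=> z _; exact: is_derive_gapcomb.
- by apply: continuous_subspaceT => z; exact: gapcomb_continuous.
by rewrite distrC E normrM [`|y - x|]distrC ler_wpM2r.
Qed.

Definition scale_comb (a : R) s := [seq (a * c.1, c.2) | c <- s].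

Lemma gapcomb_scale a s x : gapcomb (scale_comb a s) x = a * gapcomb s x.
Proof.
rewrite /gapcomb big_map mulr_sumr; apply: eq_bigr => c _ /=; exact: esym (mulrA _ _ _).
Qed.

Lemma derive_line (V W : normedModType R) (f : V -> W) (x v : V) :
  'D_v f x = 'D_1 (fun t : R => f (t *: v + x)) 0.
Proof.
rewrite /derive; set u := (X in lim X = _).
rewrite (_ : (fun h => _) = (fun h => h^-1 *: ((f \o shift x) (h *: v) - f x)))//.
by apply/funext => h /=; rewrite addr0 scale0r add0r /GRing.scale /= mulr1.
Qed.

Section separable.
Variable m : nat.
Implicit Types (z v : 'rV[R]_m) (S : 'I_m -> seq (R * (nat * nat))).

Definition sepcomb S z : R := \sum_(i < m) gapcomb (S i) (z 0 i).

Lemma differentiable_sepcomb S z : differentiable (sepcomb S) z.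
Proof.
have -> : sepcomb S = \sum_(i < m) (fun z : 'rV[R]_m => gapcomb (S i) (z 0 i)).
  by apply/funext => y; rewrite fct_sumE.
apply: differentiable_sum => i.
apply: (@differentiable_comp _ _ _ _ (fun z : 'rV[R]_m => z 0 i) (gapcomb (S i))).
  exact: differentiable_coord.
by apply/derivable1_diffP; have [] := is_derive_gapcomb (S i) (z 0 i).
Qed.

Lemma derive_sepcomb S v :
  'D_v (sepcomb S) = sepcomb (fun i => scale_comb (v 0 i) (dgapcomb (S i))).
Proof.
apply/funext => z; rewrite derive_line.
have dS : is_derive (0 : R) 1 (\sum_(i < m) (fun t : R => gapcomb (S i) (t * v 0 i + z 0 i)))
    (\sum_(i < m) gapcomb (dgapcomb (S i)) (z 0 i) * v 0 i).
  apply: is_derive_sum => i.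
  have d : is_derive (0 : R) 1 (fun t : R => t * v 0 i + z 0 i) (v 0 i).
    apply: is_derive_eq (is_deriveD (is_deriveM (is_derive_id (0 : R) 1)
      (is_derive_cst (v 0 i) (0 : R) 1)) (is_derive_cst (z 0 i) (0 : R) 1)) _.
    by rewrite scaler0 !add0r addr0 /GRing.scale /= mulr1.
  apply: is_derive_eq (is_derive1_comp (is_derive_gapcomb (S i) _) d) _.
  by rewrite mul0r add0r.
have -> : (fun t : R => sepcomb S (t *: v + z)) =
    \sum_(i < m) (fun t : R => gapcomb (S i) (t * v 0 i + z 0 i)).
  apply/funext => t; rewrite fct_sumE; apply: eq_bigr => i _; congr gapcomb.
  by rewrite !mxE.
rewrite derive_val; apply: eq_bigr => i _; by rewrite gapcomb_scale mulrC.
Qed.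

(** Induction on the order, for all S at once: a directional derivative of a separable combination
    is another one. *)
Lemma smooth_sepcomb S : smooth (sepcomb S).
Proof.
move=> k; elim: k S => [|k IH] S /=.
  by move=> z _; apply: differentiable_continuous; exact: differentiable_sepcomb.
split=> [z _|v]; first exact: differentiable_sepcomb.
by rewrite derive_sepcomb; exact: IH.
Qed.
End separable.
End gap_combinations.

(** * The function with one simple zero in each gap *)

Section oscillating.
Variable R : realType.
Implicit Types x y : R.

(** This encodes exp(-1/u) exp(-1/v) (1/u - 1/v), with u and v the distances to the left and right
    ends of the gap. *)
Definition gapwave_coef : seq (R * (nat * nat)) := [:: (1, (1%N, 0%N)); (-1, (0%N, 1%N))].

Definition gapwave x : R := gapcomb gapwave_coef x.
Definition dgapwave x : R := gapcomb (dgapcomb gapwave_coef) x.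

Lemma gapwaveE x : gapwave x = gapf 1 0 x - gapf 0 1 x.
Proof. by rewrite /gapwave /gapcomb !big_cons big_nil /= addr0 mul1r mulN1r. Qed.

Lemma gapwaveN x : gapwave (- x) = - gapwave x.
Proof. by rewrite !gapwaveE !gapfN opprB. Qed.

Lemma gapwave_gapE x : ~ cantor x -> gapwave x =
  gapf 0 0 x * ((x - cprev x)^-1 - (cnext x - x)^-1).
Proof.
move=> Kx; rewrite gapwaveE /gapf !flatS ?subr_gt0; first by ring.
  exact: cnext_gt.
exact: cprev_lt.
Qed.

Lemma gapf_gt0 i j x : ~ cantor x -> 0 < gapf i j x.
Proof.
by move=> Kx; rewrite mulr_gt0 ?flat_gt0 ?subr_gt0 ?cprev_lt ?cnext_gt.
Qed.

Lemma gapwave_eq0 x : ~ cantor x -> gapwave x = 0 -> x - cprev x = cnext x - x.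
Proof.
move=> Kx; rewrite gapwave_gapE// => /eqP; rewrite mulf_eq0 gt_eqF ?gapf_gt0//=.
by rewrite subr_eq0 => /eqP/invr_inj.
Qed.

Lemma gapwave_midpoint x : ~ cantor x -> x - cprev x = cnext x - x ->
  gapwave x = 0 /\ dgapwave x != 0.
Proof.
move=> Kx xE; split; first by rewrite gapwave_gapE// xE subrr mulr0.
have r0 : 0 < x - cprev x by rewrite subr_gt0 cprev_lt.
rewrite /dgapwave /gapcomb /dgapcomb /= !big_cons big_nil /= /gapf -xE !flatS//.
set r := x - cprev x in r0 *; have e0 := flat_gt0 0 r0.
set e := flat 0 r in e0 *.
(* At the midpoint both distances equal r; the terms in r^-3 cancel and only those in r^-2
   remain. *)
set lhs := (X in X != 0); have -> : lhs = - 2 * (r^-1 * e) ^+ 2 by rewrite /lhs; ring.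
by rewrite mulf_neq0// expf_neq0// mulf_neq0 ?invr_eq0 ?gt_eqF.
Qed.

(** The zeros are the Cantor points, a null set, and the gap midpoints, which are isolated from each
    other and hence countable. *)
Lemma gapwave_zeros_measure0 : lebesgue_measure [set x : R | gapwave x = 0] = 0%E.
Proof.
pose M := [set x : R | ~ cantor x /\ x - cprev x = cnext x - x].
have M0 : lebesgue_measure M = 0%E.
  apply: countable_lebesgue_measure0; apply: isolated_countable => t [Kt tE].
  exists (t - cprev t); first by rewrite subr_gt0 cprev_lt.
  move=> y [Ky yE]; rewrite ltr_norml => /andP[? ?].
  have [|p n] := @gap_eq R t y; first by apply/andP; split; lra.
  by move: yE; rewrite p n; lra.
apply/eqP; rewrite eq_le measure_ge0 andbT.
apply: (@le_trans _ _ (lebesgue_measure (@cantor R `|` M))).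
  apply: le_mu_ext => x /= gx; have [Kx|Kx] := pselect (cantor x); first by left.
  by right; split => //; exact: gapwave_eq0.
apply: le_trans; first exact: outer_measureU2.
by rewrite [X in (X + _)%E]cantor_measure0 [X in (_ + X)%E]M0 adde0.
Qed.

(** An interval contained in the Cantor set would have positive measure. *)
Lemma cantor_complement_dense x y : x < y -> exists2 z, x < z < y & ~ cantor z.
Proof.
move=> xy; apply: contrapT => H.
have : (lebesgue_measure (`]x, y[ : set R) <= lebesgue_measure (@cantor R))%E.
  apply: le_mu_ext => z /=; rewrite in_itv/= => xzy; apply: contrapT => Kz.
  by apply: H; exists z.
by rewrite cantor_measure0 lebesgue_measure_itv/= lte_fin xy -EFinD lee_fin; lra.
Qed.

(** Between the two Cantor points x and y there is a gap, and its midpoint is as close to x as y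
    is. *)
Lemma midpoint_near x e : cantor x -> 0 < e ->
  (exists2 y, cantor y & 0 < `|y - x| < e) ->
  exists y, [/\ `|y - x| < e, gapwave y = 0 & dgapwave y != 0].
Proof.
move=> Kx e0 [y Ky /andP[yx ye]].
pose a := Num.min x y; pose b := Num.max x y.
have [Ka Kb ab [aB bB]] : [/\ cantor a, cantor b, a < b & x - e < a /\ b < x + e].
  move: yx ye; rewrite normr_gt0 subr_eq0 ltr_norml => yx /andP[ye1 ye2].
  rewrite /a /b; case: (ltgtP x y) yx => [xy|xy|->]; rewrite ?eqxx// => _.
    by split => //; lra.
  by split => //; lra.
have [z /andP[az zb] Kz] := cantor_complement_dense ab.
have pz := le_cprev Ka (ltW az); have nz := cnext_le Kb (ltW zb).
have pz' := cprev_lt Kz; have nz' := cnext_gt Kz.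
pose w := (cprev z + cnext z) / 2.
have [|pw nw] := @gap_eq R z w; first by rewrite /w; apply/andP; split; lra.
have Kw : ~ cantor w by move=> /cprev_id; rewrite pw /w; lra.
have [|gw dgw] := gapwave_midpoint Kw; first by rewrite pw nw /w; lra.
by exists w; split => //; rewrite ltr_norml /w; apply/andP; split; lra.
Qed.

Lemma gapwave_gt0 : exists x, 0 < gapwave x.
Proof.
have [z _ Kz] := @cantor_complement_dense 0 1 ltr01.
have pz := cprev_lt Kz; have nz := cnext_gt Kz.
(* The point at one third of the gap is nearer to the left end, so 1/u > 1/v there. *)
pose w := (2 * cprev z + cnext z) / 3.
have [|pw nw] := @gap_eq R z w; first by rewrite /w; apply/andP; split; lra.
have Kw : ~ cantor w by move=> /cprev_id; rewrite pw /w; lra.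
exists w; rewrite gapwave_gapE// mulr_gt0 ?gapf_gt0// subr_gt0.
by rewrite pw nw ltf_pV2 ?posrE /w; lra.
Qed.
End oscillating.

(** * Lebesgue negligible sets in dimension m *)

Section negligible.
Variable R : realType.

Lemma null_interval_cover (Z : set R) (e : R) : lebesgue_measure Z = 0%E -> 0 < e ->
  exists c d : nat -> R, [/\ forall n, c n <= d n,
    Z `<=` \bigcup_n [set x | c n <= x <= d n] &
    (\sum_(0 <= n <oo) (d n - c n)%:E <= e%:E)%E].
Proof.
move=> Z0 e0.
have : ((wlength idfun)^*%mu Z) = 0%E by exact: Z0.
rewrite measurable_realfun.outer_measure_open_itv_cover => inf0.
have [|_ [F [Fitv ZF] <-]] := lb_ereal_inf_adherent (S := [set
  (\sum_(0 <= k <oo) wlength idfun (F k))%E | F in open_itv_cover Z]) e0.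
  by rewrite inf0.
rewrite inf0 add0e => Fe.
have /choice[cd cdP] : forall n, exists cd : R * R, cd.1 <= cd.2 /\
    F n `<=` [set x | cd.1 <= x <= cd.2] /\ wlength idfun (F n) = (cd.2 - cd.1)%:E.
  move=> n; have [[a b] ->] := Fitv n.
  have [ab|ba] := ltP a b.
    exists (a, b); rewrite (ltW ab); split => //; split.
      by move=> x; rewrite /= in_itv/= => /andP[/ltW-> /ltW->].
    by rewrite wlength_itv/= lte_fin ab.
  (* An empty open interval is replaced by the degenerate interval [0, 0], which keeps the ends
     ordered. *)
  exists (0, 0); split => //; rewrite set_itv_ge -?leNgt//.
  by split; [exact: sub0set|rewrite wlength0 subrr].
exists (fun n => (cd n).1), (fun n => (cd n).2); split.
- by move=> n; case: (cdP n).
- by move=> x /ZF[n _ Fx]; exists n => //; have [_ [/(_ _ Fx)]] := cdP n.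
- apply/ltW; apply: le_lt_trans Fe.
  by apply: lee_nneseries => n *; have [? [_ E]] := cdP n; rewrite ?E// lee_fin subr_ge0.
Qed.

Variable m : nat.
Implicit Types A : set 'rV[R]_m.

Lemma box_volume_ge0 (a b : 'rV[R]_m) :
  (forall i, a 0 i <= b 0 i) -> 0 <= box_volume a b.
Proof. by move=> ab; apply: prodr_ge0 => i _; rewrite subr_ge0. Qed.

Lemma lebesgue_negligibleP A : lebesgue_negligible A <->
  forall e : R, 0 < e -> exists a b : nat -> 'rV[R]_m,
    [/\ forall n i, a n 0 i <= b n 0 i, A `<=` \bigcup_n box (a n) (b n) &
        (\sum_(0 <= n <oo) (box_volume (a n) (b n))%:E <= e%:E)%E].
Proof.
rewrite /lebesgue_negligible /lebesgue_outer; set S := (X in ereal_inf X).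
split=> [S0 e e0|H].
  have [|_ [a [b [ab Aab ->]]]] := @lb_ereal_inf_adherent R S e e0; first by rewrite S0.
  by rewrite S0 add0e => /ltW le; exists a, b.
apply/eqP; rewrite eq_le; apply/andP; split.
  apply/lee_addgt0Pr => e e0; rewrite add0e.
  have [a [b [ab Aab le]]] := H e e0; apply: le_trans le.
  by apply: ereal_inf_lbound; exists a, b.
apply: le_ereal_inf_tmp => _ [a [b [ab _ ->]]].
by apply: nneseries_ge0 => n _ _; rewrite lee_fin box_volume_ge0.
Qed.

Lemma lebesgue_negligibleS A B : A `<=` B -> lebesgue_negligible B -> lebesgue_negligible A.
Proof.
move=> AB /lebesgue_negligibleP H; apply/lebesgue_negligibleP => e /H[a [b [? Bab ?]]].
by exists a, b; split => //; exact: subset_trans Bab.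
Qed.

(** The n-th set gets a cover of volume at most e / 2^(n+1), and a bijection from [nat] to
    [nat * nat] turns the double family of boxes into a sequence. *)
Lemma lebesgue_negligible_bigcup (F : nat -> set 'rV[R]_m) :
  (forall n, lebesgue_negligible (F n)) -> lebesgue_negligible (\bigcup_n F n).
Proof.
move=> F0; apply/lebesgue_negligibleP => e e0.
have /choice[ab abP] : forall n, exists ab : (nat -> 'rV[R]_m) * (nat -> 'rV[R]_m),
    [/\ forall k i, ab.1 k 0 i <= ab.2 k 0 i, F n `<=` \bigcup_k box (ab.1 k) (ab.2 k) &
        (\sum_(0 <= k <oo) (box_volume (ab.1 k) (ab.2 k))%:E <= (e / (2 ^ n.+1)%:R)%:E)%E].
  move=> n; have /lebesgue_negligibleP/(_ (e / (2 ^ n.+1)%:R))[] := F0 n.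
    by rewrite divr_gt0// ltr0n expn_gt0.
  by move=> a [b abP]; exists (a, b).
have /card_set_bijP[p pbij] : ([set: nat] #= [set: nat * nat])%card.
  by rewrite card_eq_sym; exact: card_nat2.
exists (fun k => (ab (p k).1).1 (p k).2), (fun k => (ab (p k).1).2 (p k).2).
have ab0 n k : (0 <= (box_volume ((ab n).1 k) ((ab n).2 k))%:E)%E.
  by rewrite lee_fin box_volume_ge0// => i; case: (abP n).
have sumE (u : nat -> \bar R) : (forall n, 0 <= u n)%E ->
    (\sum_(0 <= n <oo) u n = \esum_(n in [set: nat]) u n)%E.
  by move=> u0; rewrite nneseries_esum// set_true.
split.
- by move=> k i; case: (abP (p k).1).
- move=> x [n _ Fx]; have [_ /(_ _ Fx)[k _ xk] _] := abP n.
  have [_ _ /(_ (n, k) I)[l _ pl]] := pbij; exists l => //.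
  by rewrite pl.
- rewrite sumE; last by move=> *; exact: ab0.
  pose V (q : nat * nat) := ((box_volume ((ab q.1).1 q.2) ((ab q.1).2 q.2))%:E : \bar R)%E.
  rewrite -(reindex_esum _ _ _ V pbij).
  rewrite (_ : [set: nat * nat] = [set: nat] `*`` (fun=> [set: nat])); last first.
    by apply/seteqP; split.
  rewrite -(@esum_esum _ _ _ _ _ (fun n k => V (n, k))) => [|*]; last exact: ab0.
  rewrite (eq_esum (b := fun n => \sum_(0 <= k <oo) V (n, k))%E); last first.
    by move=> n _; rewrite sumE// => *; exact: ab0.
  rewrite -sumE; last first.
    by move=> n; apply: nneseries_ge0 => *; exact: ab0.
  apply: (@le_trans _ _ (\sum_(0 <= n <oo) (0 + (e / (2 ^ n.+1)%:R)%:E))%E).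
    apply: lee_nneseries => n *; first by apply: nneseries_ge0 => *; exact: ab0.
    by rewrite add0e; case: (abP n).
  apply: (le_trans (epsilon_trick _ _ _)) => //; first exact: ltW.
  by rewrite eseries0// add0e.
Qed.

(** Inside a cube, boxes are products of small intervals covering Z with a cross-section of fixed
    volume V; countably many cubes exhaust the space. *)
Lemma lebesgue_negligible_slab (Z : set R) (i : 'I_m) :
  lebesgue_measure Z = 0%E -> lebesgue_negligible [set x : 'rV[R]_m | Z (x 0 i)].
Proof.
move=> Z0.
apply: (@lebesgue_negligibleS _ (\bigcup_N
    [set x : 'rV[R]_m | Z (x 0 i) /\ forall j, `|x 0 j| <= N%:R])).
  move=> x Zx; exists (Num.truncn (\sum_j `|x 0 j|)).+1 => //; split => // j.
  apply: (@le_trans _ _ (\sum_j `|x 0 j|)).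
    by rewrite (bigD1 j)//= lerDl sumr_ge0.
  by rewrite ltW// truncnS_gt.
apply: lebesgue_negligible_bigcup => N; apply/lebesgue_negligibleP => e e0.
pose V : R := \prod_(j < m | j != i) (N%:R - - N%:R).
have V0 : 0 <= V by apply: prodr_ge0 => j _; rewrite opprK addr_ge0.
(* V may be 0, when N = 0, hence the divisor V + 1. *)
have [|c [d [cd Zcd scd]]] := @null_interval_cover Z (e / (V + 1)) Z0.
  by rewrite divr_gt0//; lra.
exists (fun n => \row_j if j == i then c n else - N%:R),
       (fun n => \row_j if j == i then d n else N%:R); split.
- by move=> n j; rewrite !mxE; case: ifP => // _; rewrite ge0_cp.
- move=> x [/Zcd[n _ xn] xN]; exists n => // j; rewrite !mxE.
  by case: eqP => [->//|_]; rewrite -ler_norml.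
- have vE n : box_volume (\row_j if j == i then c n else - N%:R)
      (\row_j if j == i then d n else N%:R) = V * (d n - c n).
    rewrite /box_volume (bigD1 i)//= !mxE eqxx mulrC; congr (_ * _).
    by apply: eq_bigr => j /negbTE ji; rewrite !mxE ji.
  under eq_eseriesr do rewrite vE EFinM.
  rewrite nneseriesZl; last by move=> n _; rewrite lee_fin subr_ge0.
  apply: (@le_trans _ _ (V%:E * (e / (V + 1))%:E)%E); first by rewrite lee_wpmul2l.
  rewrite -EFinM lee_fin mulrA ler_pdivrMr; last by lra.
  by rewrite mulrC; nra.
Qed.
End negligible.

(** * Sums of absolute values along curves *)

Section kinks.
Variable R : realType.

Lemma is_derive_near (f : R -> R) (x d e : R) : is_derive x 1 f d -> 0 < e ->
  \forall h \near (0 : R), `|f (x + h) - f x - d * h| <= e * `|h|.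
Proof.
move=> /is_derive1_caratheodory[q [fq qc qx]] e0.
have : \forall z \near x, `|q x - q z| < e by move/cvgrPdist_lt : qc; exact.
move=> /nbhs_ballP[r /= r0 rq]; apply/nbhs_ballP; exists r => //= h.
rewrite /ball /= sub0r normrN => hr.
rewrite fq [x + h]addrC addrK -qx -mulrBl normrM ler_wpM2r// ltW// distrC addrC.
by apply: rq; rewrite /ball /= opprD addrA subrr sub0r normrN.
Qed.

(* Second differences: those of |u| are bounded below by minus those of u,
   so the convex kinks of the summands cannot cancel. *)
Lemma sum_norm_not_derivable (m : nat) (u : 'I_m -> R -> R) (du : 'I_m -> R)
    (x d : R) (i : 'I_m) : (forall j, is_derive x 1 (u j) (du j)) ->
  is_derive x 1 (fun s => \sum_j `|u j s|) d -> u i x = 0 -> du i = 0.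
Proof.
move=> uj dF ui0; apply/eqP/negPn/negP => dui0.
have n0 : 0 < `|du i| by rewrite normr_gt0.
(* The m summands and the sum itself each contribute an error e, so differentiability would yield
   |du i| <= (m + 1) e. *)
pose e := `|du i| / m.+2%:R; have e0 : 0 < e by rewrite divr_gt0.
have near_u := filter_forall (nbhs_filter (0 : R)) (fun j => is_derive_near (uj j) e0).
have /nbhs_ballP[r /= r0 rP] : \forall h \near (0 : R),
    (forall j, `|u j (x + h) - u j x - du j * h| <= e * `|h|) /\
    `|\sum_j `|u j (x + h)| - \sum_j `|u j x| - d * h| <= e * `|h|.
  exact: filterI near_u (is_derive_near dF e0).
pose h := r / 2; have h0 : 0 < h by rewrite divr_gt0.
have [|uh Fh] := rP h; first by rewrite /ball /= sub0r normrN (gtr0_norm h0)//= /h; lra.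
have [|uh' Fh'] := rP (- h).
  by rewrite /ball /= sub0r normrN normrN (gtr0_norm h0)//= /h; lra.
(* For j other than i, |u_j| is at least u_j times the sign of u_j(x). For i, both |u_i(x + h)| and
   |u_i(x - h)| are at least (|du i| - e) h. *)
have lowj j : - (2 * e * h) + (if j == i then 2 * `|du i| * h else 0) <=
    `|u j (x + h)| + `|u j (x - h)| - 2 * `|u j x|.
  have := uh j; have := uh' j; rewrite normrN !(gtr0_norm h0).
  case: eqP => [->|_].
    rewrite ui0 normr0 mulr0 !subr0 => h1 h2.
    have {}h1 : `|du i * h| - e * h <= `|u i (x - h)|.
      have := ler_normB (u i (x - h) - du i * - h) (u i (x - h)).
      rewrite mulrN opprK addrAC subrr add0r; move: h1; rewrite mulrN opprK; lra.
    have {}h2 : `|du i * h| - e * h <= `|u i (x + h)|.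
      have := ler_normB (u i (x + h) - du i * h) (u i (x + h)).
      by rewrite addrAC subrr sub0r normrN; lra.
    by move: h1 h2; rewrite normrM (gtr0_norm h0); lra.
  rewrite mulrN opprK => /ler_normlP[a1 a2] /ler_normlP[b1 b2].
  have := ler_norm (u j (x + h)); have := ler_norm (- u j (x + h)).
  have := ler_norm (u j (x - h)); have := ler_norm (- u j (x - h)); rewrite !normrN.
  have [ujx|ujx] := ger0P (u j x); lra.
have := @ler_sum _ _ (index_enum 'I_m) xpredT _ _ (fun j _ => lowj j).
rewrite sumrB !big_split/= -mulr_sumr sumr_const card_ord -big_mkcond/= big_pred1_eq.
move: Fh Fh'; rewrite normrN (gtr0_norm h0) mulrN opprK.
move=> /ler_normlP[_ a2] /ler_normlP[_ b2] H.
have : 2 * `|du i| * h <= (2 * m.+1%:R * e) * h.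
  by move: a2 b2 H; rewrite -mulr_natl -natr1; lra.
rewrite ler_pM2r// -mulrA ler_pM2l// /e mulrA ler_pdivlMr//.
by rewrite mulrC ler_pM2r// ler_nat ltnn.
Qed.


(** For small h, c(h) and c(-h) differ from c(0) + d h and c(0) - d h by at most |d| h / 2, so they
    lie on opposite sides of c(0), at distance at least |d| h / 2; the intermediate value theorem
    concludes. *)
Lemma surjective_near (c : R -> R) (d r : R) : is_derive (0 : R) 1 c d -> d != 0 -> 0 < r ->
  (forall s, `|s| < r -> {for s, continuous c}) ->
  exists2 e, 0 < e & forall y, `|y - c 0| < e -> exists2 s, `|s| < r & c s = y.
Proof.
move=> dc d0 r0 cc.
have n0 : 0 < `|d| by rewrite normr_gt0.
have e0 : 0 < `|d| / 2 by rewrite divr_gt0.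
have /nbhs_ballP[q /= q0 qP] := is_derive_near dc e0.
pose h := Num.min q r / 2.
have h0 : 0 < h by rewrite divr_gt0// lt_min q0.
have hq : h < q by rewrite ltr_pdivrMr// mulr_natr mulr2n gt_min; apply/orP; left; lra.
have hr : h < r by rewrite ltr_pdivrMr// mulr_natr mulr2n gt_min; apply/orP; right; lra.
exists (`|d| / 2 * h); first by rewrite mulr_gt0.
move=> y; rewrite ltr_norml => /andP[y1 y2].
have := qP h; rewrite /ball /= sub0r normrN (gtr0_norm h0)// add0r => /(_ hq) c1.
have := qP (- h); rewrite /ball /= sub0r !normrN (gtr0_norm h0)// add0r mulrN opprK.
move=> /(_ hq) c2.
have [|||s] := @IVT R c (- h) h y.
- lra.
- apply: continuous_in_subspaceT => s; rewrite inE/= in_itv/= => /andP[? ?].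
  by apply: cc; rewrite ltr_norml; apply/andP; split; lra.
- move/ler_normlP : c1 => [a1 a2]; move/ler_normlP : c2 => [b1 b2].
  rewrite ge_min le_max.
  case: (ltrgt0P d) d0 a1 a2 b1 b2 y1 y2 => [dp|dn|->]; rewrite ?eqxx// => _ a1 a2 b1 b2 y1 y2.
    by apply/andP; split; apply/orP; [left|right]; lra.
  by apply/andP; split; apply/orP; [right|left]; lra.
rewrite in_itv/= => /andP[s1 s2] cs; exists s => //.
by rewrite ltr_norml; apply/andP; split; lra.
Qed.

Lemma is_derive_gapwave_comp (c : R -> R) (s w : R) :
  is_derive s 1 c w -> is_derive s 1 (fun s => gapwave (c s)) (dgapwave (c s) * w).
Proof. exact: (is_derive1_comp (is_derive_gapcomb _ (c s))). Qed.

(** If [w j 0] were nonzero, [c j] would meet a gap midpoint at a time s so small that [w j s] is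
    nonzero, and [sum_norm_not_derivable] at s is contradicted. For the height, every
    [gapwave (c j s)] has value and derivative 0 at s = 0, so F(s) = o(s). *)
Lemma curve_velocity_eq0 (m : nat) (c w : 'I_m -> R -> R) (F dF : R -> R) (t r : R) :
  0 < r ->
  (forall j (s : R), `|s| < r -> is_derive s 1 (c j) (w j s)) ->
  (forall s : R, `|s| < r -> is_derive s 1 F (dF s)) ->
  (forall s, `|s| < r -> F s = \sum_j `|gapwave (c j s)|) ->
  (forall j, {for 0, continuous (w j)}) -> (forall j, c j 0 = t) -> cantor t ->
  (forall e, 0 < e -> exists2 y, cantor y & 0 < `|y - t| < e) ->
  (forall j, w j 0 = 0) /\ dF 0 = 0.
Proof.
move=> r0 dc dF' FE wc ct Kt acc; have r00 : `|0 : R| < r by rewrite normr0.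
have F'E (s : R) : `|s| < r -> is_derive s 1 (fun s : R => \sum_j `|gapwave (c j s)|) (dF s).
  move=> sr; apply: near_eq_is_derive (dF' s sr).
  have sr0 : 0 < r - `|s| by rewrite subr_gt0.
  apply/nbhs_ballP; exists (r - `|s|) => //= y; rewrite /ball /= => sy.
  by apply: FE; have := ler_normD (y - s) s; rewrite subrK distrC; lra.
split.
  move=> j; apply/eqP/negPn/negP => wj0.
  have : \forall s \near (0 : R), w j s != 0.
    have /cvgrPdist_lt/(_ `|w j 0|) := wc j; rewrite normr_gt0 => /(_ wj0).
    apply: filterS => s; apply: contraTneq => ->; by rewrite subr0 ltxx.
  move=> /nbhs_ballP[q /= q0 qP].
  have rq0 : 0 < Num.min q r by rewrite lt_min q0.
  have [|e e0 ey] := @surjective_near (c j) (w j 0) (Num.min q r) (dc j 0 r00) wj0 rq0.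
    move=> s; rewrite lt_min => /andP[_ /(dc j)[+ _]].
    by move=> /derivable1_diffP/differentiable_continuous.
  have [y [yt gy dgy]] := midpoint_near Kt e0 (acc e e0).
  have [|s] := ey y; first by rewrite ct.
  rewrite lt_min => /andP[sq sr] csy.
  have := @sum_norm_not_derivable m (fun j s => gapwave (c j s))
    (fun j => dgapwave (c j s) * w j s) s
     (dF s) j.
  rewrite csy => /(_ (fun k => is_derive_gapwave_comp (dc k s sr)) (F'E s sr) gy)/eqP.
  rewrite mulf_eq0 (negbTE dgy)/= => /eqP ws0.
  by have := qP s; rewrite /ball /= sub0r normrN ws0 eqxx => /(_ sq).
apply/eqP/negPn/negP => dF0.
have n0 : 0 < `|dF 0| by rewrite normr_gt0.
(* Again m summands and F contribute e each, giving |dF 0| <= (m + 1) e. *)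
pose e := `|dF 0| / m.+2%:R; have e0 : 0 < e by rewrite divr_gt0.
have g0 j : is_derive (0 : R) 1 (fun s => gapwave (c j s)) 0.
  apply: is_derive_eq (is_derive_gapwave_comp (dc j 0 r00)) _.
  by rewrite ct /dgapwave gapcomb_cantor// mul0r.
have near_g := filter_forall (nbhs_filter (0 : R)) (fun j => is_derive_near (g0 j) e0).
have /nbhs_ballP[q /= q0 qP] : \forall h \near (0 : R),
    (forall j, `|gapwave (c j (0 + h)) - gapwave (c j 0) - 0 * h| <= e * `|h|) /\
    `|\sum_j `|gapwave (c j (0 + h))| - \sum_j `|gapwave (c j 0)| - dF 0 * h| <= e * `|h|.
  exact: filterI near_g (is_derive_near (F'E 0 r00) e0).
pose h := q / 2; have h0 : 0 < h by rewrite divr_gt0.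
have [|uh Fh] := qP h; first by rewrite /ball /= sub0r normrN (gtr0_norm h0)//= /h; lra.
have gt0 j : gapwave (c j 0) = 0 by rewrite ct /gapwave gapcomb_cantor.
have up : \sum_j `|gapwave (c j (0 + h))| <= (e * h) *+ m.
  rewrite -[X in _ *+ X]card_ord -sumr_const; apply: ler_sum => j _.
  by have := uh j; rewrite gt0 mul0r !subr0 (gtr0_norm h0).
move: Fh; rewrite [X in _ - X - _]big1 ?subr0; last by move=> j _; rewrite gt0 normr0.
rewrite (gtr0_norm h0) => Fh.
have : `|dF 0| * h <= (m.+1%:R * e) * h.
  have := ler_normB (\sum_j `|gapwave (c j (0 + h))| - dF 0 * h) (\sum_j `|gapwave (c j (0 + h))|).
  rewrite addrAC subrr sub0r normrN normrM (gtr0_norm h0).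
  rewrite [X in _ + X]ger0_norm; last by rewrite sumr_ge0.
  by move: up; rewrite -mulr_natl -natr1; lra.
rewrite ler_pM2r// /e mulrA ler_pdivlMr//.
by rewrite mulrC ler_pM2r// ler_nat ltnn.
Qed.
End kinks.

(** * Isolated points of and curves on C^1 submanifolds *)

Section submanifolds.
Variables (R : realType) (d k : nat) (S : set 'rV[R]_d) (p : 'rV[R]_d).
Hypotheses (Sk : C1_submanifold k S) (Sp : S p).

(** A chart is injective and sends all nearby points of S to 0. *)
Lemma C1_submanifold0_isolated : k = 0%N ->
  exists2 U, nbhs p U & forall q, S q -> U q -> q = p.
Proof.
move=> k0; have [_ /(_ p Sp)[U [V [phi [psi [Up [oU oV [UV VU] _ _] E]]]]]] := Sk.
exists U; first exact: open_nbhs_nbhs.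
have phi0 q : S q -> U q -> phi q = 0.
  move=> Sq Uq; have [_ H] : (V `&` coord_subspace k) (phi q).
    by rewrite -E; exists q.
  by apply/rowP => i; rewrite mxE H// k0.
by move=> q Sq Uq; rewrite -(UV q Uq).2 -(UV p Up).2 !phi0.
Qed.

(** In a chart, the line through phi p in the first coordinate direction stays in [coord_subspace k]
    as k > 0; psi maps it back to S. Its velocity at p is nonzero by the chain rule for phi o psi =
    id. *)
Lemma C1_submanifold_curve : (0 < k)%N -> exists (r : R) (c w : R -> 'rV[R]_d),
  [/\ 0 < r, forall s : R, `|s| < r -> S (c s) /\ is_derive s 1 c (w s), c 0 = p,
      {for 0, continuous w} & w 0 <> 0].
Proof.
move=> k0; have [kd /(_ p Sp)[U [V [phi [psi [Up]]]]]] := Sk.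
move=> [oU oV [UV VU] [dphi _] [dpsi Cpsi]] E.
pose i0 : 'I_d := Ordinal (leq_trans k0 kd).
pose e1 : 'rV[R]_d := delta_mx 0 i0.
pose l (s : R) : 'rV[R]_d := s *: e1 + phi p.
have [Vp cp] : (V `&` coord_subspace k) (phi p) by rewrite -E; exists p.
have l0 : l 0 = phi p by rewrite /l scale0r add0r.
have dl (s : R) : differentiable l s.
  by apply: differentiableD => //; exact: differentiable_cst.
have lc : {for 0, continuous l} by exact: differentiable_continuous.
have /nbhs_ballP[r /= r0 rV] : \forall s \near (0 : R), V (l s).
  by apply: lc; rewrite l0; exact: open_nbhs_nbhs.
have {}rV (s : R) : `|s| < r -> V (l s).
  by move=> sr; apply: rV; rewrite /ball /= sub0r normrN.
exists r, (psi \o l), (fun s => 'D_e1 psi (l s)); split; first exact: r0.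
- move=> s sr; split.
    have : (V `&` coord_subspace k) (l s).
      split; first exact: rV.
      move=> i ki; rewrite /l !mxE cp// addr0 eqxx /=.
      case: eqP => [ii0|_]; last by rewrite mulr0.
      by move: ki; rewrite ii0 /= leqNgt k0.
    by rewrite -E => -[q [Sq Uq] lq]; rewrite /= -lq (UV q Uq).2.
  (* Both sides are the derivative at t = 0 of psi (t e1 + l s), since l (t + s) = t e1 + l s. *)
  have -> : 'D_e1 psi (l s) = 'D_1 (psi \o l) s.
    rewrite derive_line [RHS]derive_line; congr (derive _ (0 : R) (1 : R)); apply/funext => t /=.
    by rewrite /l scalerDl /GRing.scale /= mulr1 addrA.
  apply: derivableP; apply/derivable1_diffP; apply: differentiable_comp => //.
  exact/dpsi/rV.
- by rewrite /= l0 (UV p Up).2.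
- apply: (@continuous_comp _ _ _ l ('D_e1 psi)); first exact: lc.
  by apply: Cpsi; rewrite l0.
- rewrite l0 => w0.
have e1E : 'D_e1 (phi \o psi) (phi p) = e1.
  rewrite (@near_eq_derive _ _ _ _ id); first by rewrite derive_id.
  have := open_nbhs_nbhs (conj oV Vp); apply: filterS => y Vy /=; exact: (VU y Vy).2.
have dphip : differentiable phi (psi (phi p)) by rewrite (UV p Up).2; exact: dphi.
have : 'D_e1 (phi \o psi) (phi p) = 0.
  rewrite deriveE; last by apply: differentiable_comp => //; exact: dpsi.
  rewrite diff_comp//; last exact: dpsi.
  have dpsi0 : 'd psi (phi p) e1 = 0 by rewrite -deriveE//; exact: dpsi.
  by rewrite [LHS](congr1 ('d phi _) dpsi0) linear0.
rewrite e1E => /rowP/(_ i0); rewrite !mxE !eqxx /= => /eqP.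
by rewrite oner_eq0.
Qed.
End submanifolds.

(** * Absence of a stratification of the graph *)

Section oscillating_sum.
Variables (R : realType) (m : nat).
Implicit Types (x y : 'rV[R]_m) (t : R).

Definition oscillating x : R := \sum_i `|gapwave (x 0 i)|.

(** On the diagonal, whichever base coordinate moves starts from the same t, so gap midpoints
    accumulate at its starting value when t is a limit point of [cantor]. *)
Definition diagonal_lift t : 'rV[R]_(m + 1) :=
  row_mx (const_mx t) (oscillating (const_mx t))%:M.

Definition cantor_limit t := forall e, 0 < e ->
  exists2 y, cantor y & 0 < `|y - t| < e.

Lemma diagonal_lift_continuous : continuous diagonal_lift.
Proof.
move=> t; apply/cvg_ballP => e e0.
have gc : (fun s : R => m%:R * `|gapwave s|) @ t --> m%:R * `|gapwave t|.
  apply: cvgM; first exact: cvg_cst.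
  by apply: cvg_norm; exact: gapcomb_continuous.
have liftE s : oscillating (const_mx s) = m%:R * `|gapwave s|.
  rewrite /oscillating (eq_bigr (fun=> `|gapwave s|)) => [|i _]; last by rewrite mxE.
  by rewrite sumr_const card_ord mulr_natl.
near=> s; split => // i j; rewrite (ord1 i); case: (split_ordP j) => l ->.
  rewrite !row_mxEl !mxE; near: s; apply/nbhs_ballP; by exists e.
rewrite !row_mxEr !mxE ord1 eqxx !mulr1n !liftE.
by near: s; move/cvg_ballP : gc; exact.
Unshelve. all: by end_near. Qed.

(** A stratum of dimension 0 is discrete, which pulls back along the continuous [diagonal_lift].
    Positive dimension would give a curve with nonzero velocity, against [curve_velocity_eq0]. *)
Lemma stratum_isolated (S : set 'rV[R]_(m + 1)) (k : nat) t : (0 < m)%N ->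
  C1_submanifold k S -> S `<=` graph oscillating -> cantor t -> cantor_limit t ->
  S (diagonal_lift t) ->
  exists2 e, 0 < e & forall t', S (diagonal_lift t') -> `|t' - t| < e -> t' = t.
Proof.
move=> m0 Sk Sg Kt acc St; have [k0|k0] := posnP k.
  have [U Up US] := C1_submanifold0_isolated Sk St k0.
  have /nbhs_ballP[e /= e0 eU] := @diagonal_lift_continuous t U Up.
  exists e => // t' St' t't.
  have /rowP/(_ (lshift 1 (Ordinal m0))) : diagonal_lift t' = diagonal_lift t.
    by apply: US => //; apply: eU; rewrite /ball /= distrC.
  by rewrite !row_mxEl !mxE.
exfalso; have [r [c [w [r0 cS c0 wc]]]] := C1_submanifold_curve Sk St k0; apply.
have dcoord (s : R) (j : 'I_(m + 1)) : `|s| < r ->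
    is_derive s 1 (fun s : R => c s 0 j) (w s 0 j).
  move=> sr; have [_ [dc <-]] := cS s sr; rewrite derive_mx// mxE.
  by apply: derivableP; move/derivable_mxP : dc.
have FE (s : R) : `|s| < r -> c s 0 (rshift m 0) = \sum_j `|gapwave (c s 0 (lshift 1 j))|.
  move=> sr; have [/Sg[x _ <-] _] := cS s sr.
  rewrite row_mxEr !mxE eqxx mulr1n; apply: eq_bigr => j _.
  by rewrite row_mxEl.
have wlc (j : 'I_m) : {for 0, continuous (fun s : R => w s 0 (lshift 1 j))}.
  apply: (@continuous_comp _ _ _ w (fun M : 'rV[R]_(m + 1) => M 0 (lshift 1 j))).
    exact: wc.
  exact: coord_continuous.
have ct (j : 'I_m) : c 0 0 (lshift 1 j) = t by rewrite c0 row_mxEl mxE.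
have [wl wr] := curve_velocity_eq0 r0 (fun j s sr => dcoord s (lshift 1 j) sr)
  (fun s sr => dcoord s (rshift m 0) sr) FE wlc ct Kt acc.
apply/rowP => j; rewrite mxE; case: (split_ordP j) => l ->; first exact: wl.
by rewrite ord1.
Qed.

Lemma oscillating_no_stratification : (0 < m)%N ->
  ~ exists (I : set nat) (S : nat -> set 'rV[R]_(m + 1)),
      whitney_stratification (graph oscillating) I S.
Proof.
move=> m0 [I [S [[[cov _ _] _] subm _ _]]]; apply: (@cantor_uncountable R).
(* [Some i] collects the limit points of [cantor] lifted into stratum i, [None] its isolated points;
   every [D o] consists of isolated points, so the countable union is countable. *)
pose D (o : option nat) := [set t : R | cantor t /\
  if o is Some i then [/\ I i, cantor_limit t & S i (diagonal_lift t)]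
  else ~ cantor_limit t].
apply: (@sub_countable _ _ _ (\bigcup_o D o)).
  apply: subset_card_le => t Kt.
  have [acct|nacct] := pselect (cantor_limit t); last by exists None.
  have : cover I S (diagonal_lift t) by rewrite cov; exists (const_mx t).
  by move=> [i Ii Sit]; exists (Some i).
apply: bigcup_countable => [|[i|] _]; first exact: countableP.
  apply: isolated_countable => t [Kt [Ii acct Sit]]; have [k Sk] := subm i Ii.
  have SG : S i `<=` graph oscillating by rewrite -cov => q Sq; exists i.
  have [e e0 H] := stratum_isolated m0 Sk SG Kt acct Sit.
  by exists e => // t' [_ [_ _]]; exact: H.
apply: isolated_countable => t [Kt]; move=> /existsNP[e /not_implyP[e0 H]].
exists e => // t' [Kt' _] t't; apply/eqP/negPn/negP => tt'; apply: H.
by exists t' => //; rewrite normr_gt0 subr_eq0 tt'.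
Qed.
End oscillating_sum.

(** * The piecewise smooth representation and its interface *)

Section pieces.
Variables (R : realType) (m : nat).
Implicit Types (x y : 'rV[R]_m) (s : {ffun 'I_m -> bool}).

Lemma coord_le_norm x i : `|x 0 i| <= `|x|.
Proof.
by rewrite [leRHS]mx_normrE; exact: (@le_bigmax _ _ _ 0 (fun ij => `|x ij.1 ij.2|) (0, i)).
Qed.

Lemma oscillating_dist : exists2 C : R, 0 <= C &
  forall x y, `|oscillating x - oscillating y| <= C * `|x - y|.
Proof.
have [C C0 gC] := gapcomb_lipschitz (@gapwave_coef R).
exists (C *+ m) => [|x y]; first exact: mulrn_wge0.
rewrite /oscillating -sumrB; apply: (le_trans (ler_norm_sum _ _ _)).
rewrite mulrnAl -[X in _ *+ X]card_ord -sumr_const; apply: ler_sum => i _.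
apply: (le_trans (ler_dist_dist _ _)); apply: (le_trans (gC _ _)).
by rewrite ler_wpM2l//; have := coord_le_norm (x - y) i; rewrite !mxE.
Qed.

Lemma oscillating_lipschitz : lipschitz (@oscillating R m).
Proof.
have [C C0 fC] := oscillating_dist.
apply: (@klipschitzW _ _ _ C); last by move=> [x y] _ /=; exact: fC.
exact: (@globally_properfilter _ _ (0, 0)).
Qed.

Lemma oscillating_continuous : continuous (@oscillating R m).
Proof.
have [C C0 fC] := oscillating_dist => x A /nbhs_ballP[e /= e0 eA].
apply/(@nbhs_normP R 'rV[R]_m); exists (e / (C + 1)) => [|y /= xy] /=.
  by rewrite divr_gt0//; lra.
apply: eA; rewrite /ball /=; apply: (le_lt_trans (fC _ _)).
apply: (@le_lt_trans _ _ ((C + 1) * `|x - y|)); first by rewrite ler_wpM2r//; lra.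
by rewrite mulrC -ltr_pdivlMr//; lra.
Qed.

(** Zero counts as nonnegative, so that the sign patterns define disjoint sets. *)
Definition piece s : set 'rV[R]_m := [set x | forall i, (0 <= gapwave (x 0 i)) = s i].

Definition piece_fun s : 'rV[R]_m -> R :=
  sepcomb (fun i => scale_comb (if s i then 1 else -1) (@gapwave_coef R)).

Lemma coord_gapwave_continuous (i : 'I_m) : continuous (fun x : 'rV[R]_m => gapwave (x 0 i)).
Proof.
move=> x; apply: (@continuous_comp _ _ _ (fun x : 'rV[R]_m => x 0 i) (@gapwave R)).
  exact: coord_continuous.
exact: gapcomb_continuous.
Qed.

Lemma closed_gapwave_ge0 (i : 'I_m) : closed [set x : 'rV[R]_m | 0 <= gapwave (x 0 i)].
Proof.
have := @closed_comp _ _ (fun x : 'rV[R]_m => gapwave (x 0 i)) [set y : R | 0 <= y].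
by apply; [move=> x _; exact: coord_gapwave_continuous|exact: closed_ge].
Qed.

Lemma closed_gapwave_le0 (i : 'I_m) : closed [set x : 'rV[R]_m | gapwave (x 0 i) <= 0].
Proof.
have := @closed_comp _ _ (fun x : 'rV[R]_m => gapwave (x 0 i)) [set y : R | y <= 0].
by apply; [move=> x _; exact: coord_gapwave_continuous|exact: closed_le].
Qed.

Lemma borel_piece s : borel (piece s).
Proof.
pose B := [set A : set 'rV[R]_m | open A].
have -> : piece s = \bigcap_(i in [set: 'I_m]) [set x | (0 <= gapwave (x 0 i)) = s i].
  by apply/seteqP; split => x sx i; [move=> _|]; exact: sx.
apply: (@fin_bigcap_measurable _ (g_sigma_algebraType B)) => // i _.
have mge : measurable ([set x | 0 <= gapwave (x 0 i)] : set (g_sigma_algebraType B)).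
  rewrite -[X in measurable X]setCK; apply: measurableC; apply: sub_sigma_algebra.
  exact/closed_openC/closed_gapwave_ge0.
case: (s i); first exact: mge.
rewrite (_ : [set _ | _] = ~` [set x | 0 <= gapwave (x 0 i)]); first exact: measurableC.
by apply/seteqP; split => x /=; [move=> ->|move/negP/negbTE].
Qed.

Lemma piece_funE s x : piece s x -> oscillating x = piece_fun s x.
Proof.
move=> sx; apply: eq_bigr => i _; rewrite gapcomb_scale -/(gapwave _) -(sx i).
by case: ger0P => _; rewrite ?mul1r ?mulN1r.
Qed.

Lemma closure_piece s x i : closure (piece s) x ->
  if s i then 0 <= gapwave (x 0 i) else gapwave (x 0 i) <= 0.
Proof.
move=> sx; case: ifPn => si.
  apply: (closed_gapwave_ge0 (i := i)); apply: closure_subset sx => y sy /=.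
  by rewrite sy.
apply: (closed_gapwave_le0 (i := i)); apply: closure_subset sx => y sy /=.
by rewrite ltW// ltNge sy.
Qed.

Lemma oscillating_representation : is_representation (@oscillating R m)
  (fun j : 'I_#|{ffun 'I_m -> bool}| => piece (enum_val j))
  (fun j => piece_fun (enum_val j)).
Proof.
split.
- split.
  + apply/seteqP; split => // x _; exists (enum_rank [ffun i => 0 <= gapwave (x 0 i)]) => //.
    by move=> i; rewrite enum_rankK ffunE.
  + move=> j l _ _ [x [jx lx]]; apply: enum_val_inj; apply/ffunP => i.
    by rewrite -jx -lx.
  + move=> j _; have [a ga] := gapwave_gt0 R.
    (* [gapwave] is odd, so a and -a realise both signs and every pattern occurs. *)
    exists (\row_i if enum_val j i then a else - a) => i; rewrite mxE.
    by case: (enum_val j i); [rewrite ltW|rewrite gapwaveN oppr_ge0 leNgt ga].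
- by move=> j; exact: borel_piece.
- by move=> j; exact: smooth_sepcomb.
- by move=> j x; exact: piece_funE.
Qed.

(** Two patterns differ at some i, and a point in both closures then has gapwave (x_i) = 0; this is
    a finite union of null slabs. *)
Lemma interface_negligible : (0 < m)%N -> lebesgue_negligible (interface
  (fun j : 'I_#|{ffun 'I_m -> bool}| => piece (enum_val j))).
Proof.
move=> m0.
apply: (@lebesgue_negligibleS _ _ _
    (* The coordinates are indexed by [nat], with coordinate 0 as default, to fit the countable
       union lemma. *)
    (\bigcup_n [set x | gapwave (x 0 (insubd (Ordinal m0) n)) = 0])); last first.
  apply: lebesgue_negligible_bigcup => n.
  exact: (lebesgue_negligible_slab _ (gapwave_zeros_measure0 R)).
move=> x [j [l [jl [jx lx]]]].
have [i ijl] : exists i, enum_val j i != enum_val l i.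
  apply/existsP; apply: contraNT jl => /existsPn H; apply/eqP/enum_val_inj/ffunP => i.
  by apply/eqP; rewrite -[_ == _]negbK H.
exists (val i) => //=; rewrite valKd.
have := closure_piece i jx; have := closure_piece i lx; move: ijl.
by case: (enum_val j i); case: (enum_val l i) => // _ a b; apply/eqP; rewrite eq_le a b.
Qed.
End pieces.

Theorem theorem5p5 (R : realType) (m : nat) (m_gt0 : (0 < m)%N) :
  exists f : 'rV[R]_m -> R,
    [/\ lipschitz f,
        piecewise_smooth f,
        exists (J : nat) (P : 'I_J -> set 'rV[R]_m)
               (fs : 'I_J -> 'rV[R]_m -> R),
          is_representation f P fs /\ lebesgue_negligible (interface P) &
        ~ exists (I : set nat) (S : nat -> set 'rV[R]_(m + 1)),
            whitney_stratification (graph f) I S].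
Proof.
have rep := oscillating_representation R m.
exists (@oscillating R m); split.
- exact: oscillating_lipschitz.
- split; first exact: oscillating_continuous.
  by eexists _, _, _; exact: rep.
- by eexists _, _, _; split; [exact: rep|exact: interface_negligible].
- exact: oscillating_no_stratification.
Qed.
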